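(* Let $\beta>0$ and, for each rarity parameter $n>0$, let $L_n(\boldsymbol{D})$ denote the optimal value of the dual linear program when the demand vector is $\boldsymbol{D}=(D(t_1),\dots,D(t_d))'$ and the supply vector is $\boldsymbol{s}_n=(s_n(t_1),\dots,s_n(t_d))'$ with $s_n(t_i)=n^{\beta}\gamma(t_i)$. Then for all $k_n\ge 0$ with $k_n=o(n^{\beta})$ as $n\to\infty$, $$\lim_{n\to\infty} n^{-2\beta}\log P\{L_n(\boldsymbol{D})>k_n\}=\lim_{n\to\infty} n^{-2\beta}\log P\Big\{\max_{i=1,\dots,d}\big(D(t_i)-s_n(t_i)\big)>k_n\Big\}=-\frac{\gamma^2(t^* )}{2\sigma^2(t^* )},$$ where $t^*\in\arg\min_{t\in T}\frac{\gamma(t)}{\sigma(t)}$.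
   Context: Network: $G=(V,E)$ is a directed graph with $V=\{1,\dots,d\}$ ($d$ fixed) and incidence matrix $H$, where $H(i,j)=1$ if $(i,j)\in E$, $H(i,j)=0$ otherwise, and $H(i,i)=0$ for all $i$; $H$ is assumed irreducible. The matrix $A=(a_{ij})_{i,j\in V}$ satisfies $a_{ij}=0$ if $H(i,j)=0$, $a_{ij}>0$ if $H(i,j)=1$, and $\sum_{j=1}^d a_{ij}=1$ for every $i$. Supplies and demands: $T=\{t_1,\dots,t_d\}$ is the set of node locations; $\gamma,\mu,\sigma$ are fixed positive functions on $T$, and $\sigma^2(\cdot,\cdot)$ is a fixed function on $T\times T$ with $\sigma^2(t,t)=\sigma^2(t)$. The node at location $t_i$ has deterministic supply $s_n(t_i)=n^\beta\gamma(t_i)$. The demand vector $\boldsymbol{D}=(D(t_1),\dots,D(t_d))'$ does not depend on $n$ and is jointly Gaussian with $D(t_i)\sim N(\mu(t_i),\sigma^2(t_i))$ and $\mathrm{cov}[D(t_i),D(t_j)]=\sigma^2(t_i,t_j)$; its covariance matrix $\Sigma$ is symmetric positive definite. (The model also assumes that each node's expected demand is at most its supply; here this holds automatically for all large $n$.) Dual linear program: $L_n(\boldsymbol{D})=\sup\{\boldsymbol{y}'(\boldsymbol{D}-\boldsymbol{s}_n):\ \boldsymbol{y}\in\mathbb{R}^d,\ (I-A)\boldsymbol{y}\le\boldsymbol{1},\ \boldsymbol{y}\ge\boldsymbol{0}\}\in[0,\infty]$, where inequalities are componentwise, $\boldsymbol{1}$ is the all-ones vector, and the value is $+\infty$ if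 the program is unbounded. $f(n)=o(g(n))$ means that for every $C>0$ there is $N$ such that $|f(n)|<C|g(n)|$ for all $n>N$. *)

(* Defs.v *)
From HB Require Import structures.
From mathcomp Require Import all_boot all_order all_algebra.
From mathcomp Require Import all_classical all_reals all_analysis.

Set Implicit Arguments.
Unset Strict Implicit.
Unset Printing Implicit Defensive.

Import Order.TTheory GRing.Theory Num.Theory.
Import numFieldNormedType.Exports.

Local Open Scope classical_set_scope.
Local Open Scope ring_scope.

Definition incidence_mx (R : realType) (d : nat) (E : rel 'I_d) : 'M[R]_d :=
  \matrix_(i, j) (E i j)%:R.

Definition irreducible_mx (R : realType) (d : nat) (H : 'M[R]_d) : Prop :=
  forall i j : 'I_d, exists2 m : nat, (0 < m)%N & 0 < (H ^+ m) i j.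

Definition sym_posdef (R : realType) (d : nat) (S : 'M[R]_d) : Prop :=
  S^T = S /\
  forall x : 'cV[R]_d, x != 0 -> 0 < (x^T *m S *m x) ord0 ord0.

(* N(m, s^2), parametrized by the standard deviation s, with N(m, 0) the Dirac
   mass at m (the library's [normal_prob m 0] is instead uniform on [0, 1]). *)
Definition gaussian_law (R : realType) (m s : R) (B : set R) : \bar R :=
  if s == 0 then \d_m B else normal_prob m s B.

(* Laws are compared on measurable sets only: off them, neither the
   probability nor [normal_prob] has a meaningful value. *)
Definition has_gaussian_law (dO : measure_display) (Omega : measurableType dO)
    (R : realType) (P : probability Omega R) (X : Omega -> R) (m s : R) : Prop :=
  forall B : set R, measurable B -> P (X @^-1` B) = gaussian_law m s B.

Definition jointly_gaussian (dO : measure_display) (Omega : measurableType dO)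
    (R : realType) (P : probability Omega R) (d : nat)
    (X : 'I_d -> {RV P >-> R}) : Prop :=
  forall c : 'I_d -> R, exists m s : R,
    0 <= s /\ has_gaussian_law P (fun w => \sum_(i < d) c i * X i w) m s.

Definition dual_feasible (R : realType) (d : nat) (A : 'M[R]_d) :
    set 'cV[R]_d :=
  [set y | (forall i, ((1%:M - A) *m y) i ord0 <= 1) /\
           (forall i, 0 <= y i ord0)].

(* The supremum is taken in [\bar R], so an unbounded program has value +oo. *)
Definition dual_value (R : realType) (d : nat) (A : 'M[R]_d)
    (D s : 'cV[R]_d) : \bar R :=
  ereal_sup [set ((y^T *m (D - s)) ord0 ord0)%:E | y in dual_feasible A].

Definition supply (R : realType) (T : Type) (beta : R) (gamma : T -> R)
    (n : R) (x : T) : R := n `^ beta * gamma x.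

Definition argmin (R : realType) (T : Type) (f : T -> R) : set T :=
  [set x | forall y, f x <= f y].

Definition little_o (R : realType) (f g : R -> R) : Prop :=
  forall C, 0 < C -> exists N, forall n, N < n -> `|f n| < C * `|g n|.

(* Main.v *)
Require Import Defs.
From HB Require Import structures.
From mathcomp Require Import all_boot all_order all_algebra.
From mathcomp Require Import all_classical all_reals all_analysis.
From mathcomp Require Import measurable_realfun.
From mathcomp Require Import ring lra.
Import Order.TTheory GRing.Theory Num.Theory.
Import numFieldNormedType.Exports.
Local Open Scope classical_set_scope.
Local Open Scope ring_scope.

(* For [k_n >= 0] the three events are nested:
     {D_i* - s_i* > k_n} `<=` {L_n > k_n} `<=` {exists i, D_i > s_i}.
   The first inclusion holds because the unit vector [e_i*] is dual feasible,
   the second because [y >= 0] makes [y'(D - s)] nonpositive when [D <= s].  Hence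
   only the Gaussian marginals matter: the tail bounds
     c exp(-(x + 1 - m)^2 / 2s^2) <= P(N(m, s^2) > x) <= exp(-(x - m)^2 / 2s^2)
   and a union bound squeeze both probabilities on the scale [N = n^beta]. *)

(** * Tail bounds for the normal law *)

(* For [y >= x >= m], [(y - m)^2 >= (x - m)^2 + (y - x)^2], so on the tail the
   density of N(m, s^2) is at most [exp(-(x - m)^2 / 2s^2)] times that of
   N(x, s^2). *)
Lemma normal_prob_tail_le (R : realType) (m s x : R) : 0 < s -> m <= x ->
  (normal_prob m s `]x, +oo[ <= (expR (- ((x - m) ^+ 2 / (2 * s ^+ 2))))%:E)%E.
Proof.
move=> s0 mx; set c := expR _.
have mpdf a : measurable_fun `]x, +oo[ (EFin \o normal_pdf a s).
  by apply/measurable_EFinP/measurable_funTS; exact: measurable_normal_pdf.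
have pdf0 a y : (0 <= (normal_pdf a s y)%:E)%E.
  by rewrite lee_fin normal_pdf_ge0.
apply: (@le_trans _ _ (c%:E * normal_prob x s `]x, +oo[)%E); last first.
  by rewrite -[leRHS]mule1 lee_pmul2l ?lte_fin ?expR_gt0// probability_le1.
rewrite /normal_prob -ge0_integralZl//; last 2 first.
- exact: mpdf.
- by rewrite lee_fin expR_ge0.
apply: ge0_le_integral => //=.
- exact: mpdf.
- by apply: measurable_funeM; exact: mpdf.
move=> y; rewrite in_itv/= andbT => xy; rewrite -EFinM lee_fin.
rewrite !normal_pdfE ?gt_eqF// mulrCA ler_pM2l ?normal_peak_gt0 ?gt_eqF//.
rewrite /normal_fun -expRD ler_expR -(mulr_natl (s ^+ 2)).
have : 0 < (2 * s ^+ 2)^-1 by rewrite invr_gt0 mulr_gt0 ?exprn_gt0.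
move: (_^-1) => v v0; rewrite !mulNr -opprD lerN2 -mulrDl ler_pM2r//; nra.
Qed.

(** It is enough to keep the unit interval []x, x + 1]]: to the right of the mean the density
    decreases, so there it is at least its value at [x + 1]. *)
Lemma normal_prob_tail_ge (R : realType) (m s x : R) : 0 < s -> m <= x ->
  ((normal_peak s * expR (- ((x + 1 - m) ^+ 2 / (2 * s ^+ 2))))%:E <=
   normal_prob m s `]x, +oo[)%E.
Proof.
move=> s0 mx; set c := _ * _.
have mpdf : measurable_fun `]x, x + 1] (EFin \o normal_pdf m s).
  by apply/measurable_EFinP/measurable_funTS; exact: measurable_normal_pdf.
have sub : `]x, (x + 1)] `<=` `]x, +oo[.
  by move=> y /=; rewrite !in_itv/= andbT => /andP[].
apply: (@le_trans _ _ (\int[lebesgue_measure]_(y in `]x, (x + 1)%R]) c%:E)%E).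
  rewrite integral_cst// /= lebesgue_measure_itv /= lte_fin ltrDl ltr01.
  by rewrite -EFinD [x + 1]addrC addrK mule1.
apply: (@le_trans _ _ (normal_prob m s `]x, x + 1])); last first.
  by rewrite le_measure ?inE//.
rewrite /normal_prob.
apply: ge0_le_integral => //=.
- by move=> y _; rewrite lee_fin mulr_ge0 ?expR_ge0 ?normal_peak_ge0.
move=> y; rewrite in_itv/= => /andP[xy yx]; rewrite lee_fin.
rewrite normal_pdfE ?gt_eqF// ler_pM2l ?normal_peak_gt0 ?gt_eqF//.
rewrite /normal_fun ler_expR -(mulr_natl (s ^+ 2)).
have : 0 < (2 * s ^+ 2)^-1 by rewrite invr_gt0 mulr_gt0 ?exprn_gt0.
move: (_^-1) => v v0; rewrite !mulNr lerN2 ler_pM2r//; nra.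
Qed.

(** * The dual program: bounds on its value and measurability *)

(** The entries of column [i] of [I - A] are at most 1 because column [i] of [A] is nonnegative; so
    the unit vector is feasible, and its objective is the excess demand at [i]. *)
Lemma le_dual_value (R : realType) (d : nat) (A : 'M[R]_d) (D s : 'cV[R]_d)
    (i : 'I_d) : (forall j, 0 <= A j i) ->
  ((D i ord0 - s i ord0)%:E <= dual_value A D s)%E.
Proof.
move=> A0; apply: ereal_sup_ubound; exists (delta_mx i ord0).
  split=> j; last by rewrite !mxE eqxx andbT ler0n.
  rewrite -colE !mxE; apply: (@le_trans _ _ (j == i)%:R); last by case: eqP.
  by rewrite lerBlDr lerDl.
by rewrite trmx_delta -rowE !mxE.
Qed.

Lemma dual_value_gt0 (R : realType) (d : nat) (A : 'M[R]_d) (D s : 'cV[R]_d) :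
  (0 < dual_value A D s)%E -> exists i, s i ord0 < D i ord0.
Proof.
move=> /ereal_sup_gt[_ [y [_ y0] <-]]; rewrite lte_fin mxE => h.
apply: contrapT => /forallNP Ds; move: h; apply/negP; rewrite -leNgt.
apply: sumr_le0 => i _; rewrite !mxE mulr_ge0_le0// subr_le0 leNgt.
exact/negP.
Qed.

(* Since [y >= 0], the value is nondecreasing in the demand, so that the event
   is a union of orthants with rational corners. *)
Lemma measurable_dual_value_gt (R : realType) (d : nat) (A : 'M[R]_d)
    (s : 'cV[R]_d) (k : R) (dO : measure_display) (Omega : measurableType dO)
    (X : 'I_d -> Omega -> R) (mX : forall i, measurable_fun setT (X i)) :
  measurable [set w | (k%:E < dual_value A (\col_i X i w) s)%E].
Proof.
pose Q (q : {ffun 'I_d -> rat}) := \col_i (ratr (q i) : R).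
pose B q := [set w | (k%:E < dual_value A (Q q) s)%E /\
                     forall i, ratr (q i) <= X i w].
rewrite (_ : mkset _ = \bigcup_q B q); last first.
  apply/seteqP; split=> w /=; last first.
    move=> [q _ [+ qX]] => /ereal_sup_gt[_ [y fy <-] ky].
    apply: lt_le_trans ky _; apply: le_trans; last first.
      by apply: ereal_sup_ubound; exists y.
    rewrite lee_fin !mxE; apply: ler_sum => i _; rewrite !mxE.
    by apply: ler_wpM2l; [case: fy|rewrite lerD2r].
  move=> /ereal_sup_gt[_ [y fy <-]]; rewrite lte_fin => ky.
  (* Lowering each demand by at most [e] costs at most [e * \sum_i y i ord0]. Since
     [e * (1 + \sum_i y i ord0)] is the whole gap above [k], a margin [e > 0] remains. *)
  pose e := ((y^T *m (\col_i X i w - s)) ord0 ord0 - k) /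
            (1 + \sum_i y i ord0).
  have S0 : 0 <= \sum_i y i ord0 by apply: sumr_ge0 => i _; case: fy.
  have e0 : 0 < e by rewrite divr_gt0 ?subr_gt0// ltr_pwDl.
  have /choice[q qP] i : exists q : rat, X i w - e < ratr q < X i w.
    have /rat_in_itvoo[q] : X i w - e < X i w by rewrite ltrBlDr ltrDl.
    by rewrite in_itv/= => ?; exists q.
  exists [ffun i => q i] => //; split=> [|i]; last first.
    by rewrite ffunE; case/andP: (qP i) => _ /ltW.
  apply: (@lt_le_trans _ _ ((y^T *m (Q [ffun i => q i] - s)) ord0 ord0)%:E);
    last by apply: ereal_sup_ubound; exists y.
  rewrite lte_fin.
  have : (y^T *m (\col_i X i w - s)) ord0 ord0 - e * \sum_i y i ord0 <=
         (y^T *m (Q [ffun i => q i] - s)) ord0 ord0.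
    rewrite !mxE mulr_sumr -sumrB; apply: ler_sum => i _; rewrite !mxE ffunE.
    rewrite [e * _]mulrC -mulrBr; apply: ler_wpM2l; first by case: fy.
    by case/andP: (qP i) => /ltW; lra.
  apply: lt_le_trans.
  have : e * (1 + \sum_i y i ord0) = (y^T *m (\col_i X i w - s)) ord0 ord0 - k.
    by rewrite divfK// gt_eqF// ltr_pwDl.
  lra.
apply: countable_bigcupT_measurable => [|q]; first exact: countableP.
(* The first condition in [B q] does not involve [w], so [B q] is either empty or a full orthant. *)
case: (pselect (k%:E < dual_value A (Q q) s)%E) => h; last first.
  rewrite (_ : B q = set0)//.
  by apply/seteqP; split => w // [].
rewrite (_ : B q = \bigcap_(i in [set: 'I_d]) (X i @^-1` `[ratr (q i), +oo[)).
  apply: fin_bigcap_measurable => [|i _]; first exact: finite_finset.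
  by rewrite -[X in measurable X]setTI; apply: mX.
apply/seteqP; split => w /=.
  by move=> [_ +] i _ => /(_ i); rewrite /= in_itv/= andbT.
by move=> H; split=> // i; have := H i I; rewrite /= in_itv/= andbT.
Qed.

(** * Union bound and limits on the logarithmic scale *)

Lemma probability_bigsetU_le (R : realType) (dO : measure_display)
    (Omega : measurableType dO) (P : probability Omega R) (I : finType)
    (A : I -> set Omega) (u : R) :
  (forall i, measurable (A i)) -> (forall i, (P (A i) <= u%:E)%E) ->
  (P (\big[setU/set0]_i A i) <= (#|I|%:R * u)%:E)%E.
Proof.
move=> mA Au.
have -> : (#|I|%:R * u)%:E = (\sum_(i : I) u%:E)%E.
  by rewrite sumEFin sumr_const mulr_natl.
(* Measurability of the partial unions is carried through the induction because subadditivity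
   requires it. *)
suff [] : measurable (\big[setU/set0]_i A i) /\
  (P (\big[setU/set0]_i A i) <= \sum_(i : I) u%:E)%E by [].
elim/big_ind2 : _ => [|x1 x2 y1 y2 [m1 h1] [m2 h2]|i _].
- by rewrite measure0.
- split; first exact: measurableU.
  by apply: le_trans (leeD h1 h2); exact: measureU2.
- by split.
Qed.

(** After taking logarithms and dividing by [N ^ 2], the prefactors contribute [O(N ^ -2)], the
    linear error [K / N], and the shift [k + 1] becomes [k / N + 1 / N]. All of these vanish, so
    both bounds tend to [- g ^ 2 / v]. *)
Lemma cvg_scaled_lne (R : realType) (F : set_system R) (FF : Filter F)
    (N k : R -> R) (p : R -> \bar R) (b c g v K : R) :
  0 < b -> 0 < c -> 0 < v ->
  N n @[n --> F] --> +oo -> k n / N n @[n --> F] --> 0 ->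
  (\forall n \near F,
     (b * expR (- ((N n * g + k n + 1) ^+ 2 / v)))%:E <= p n <=
     (c * expR (K * N n - g ^+ 2 / v * N n ^+ 2))%:E)%E ->
  (((N n ^- 2)%:E * lne (p n))%E @[n --> F] --> (- (g ^+ 2 / v))%:E).
Proof.
move=> b0 c0 v0 Noo kN pN.
have N0 : \forall n \near F, 0 < N n by move/cvgryPgt : Noo; exact.
have Ni0 : (N n)^-1 @[n --> F] --> 0 by apply/(gtr0_cvgV0 N0).
have N20 : N n ^- 2 @[n --> F] --> 0.
  rewrite -(mulr0 0); under eq_fun do rewrite -exprVn expr2.
  by apply: cvgM.
apply: (@squeeze_cvge _ _ _ _
  (fun n => (N n ^- 2 * ln b - (g + k n / N n + (N n)^-1) ^+ 2 / v)%:E) _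
  (fun n => (N n ^- 2 * ln c + K * (N n)^-1 - g ^+ 2 / v)%:E)); last 2 first.
- apply/cvg_EFin; first by near=> n.
  have -> : - (g ^+ 2 / v) = 0 * ln b - (g + 0 + 0) * (g + 0 + 0) * v^-1.
    by rewrite mul0r add0r !addr0 expr2.
  have gN : g + k n / N n + (N n)^-1 @[n --> F] --> g + 0 + 0.
    by apply: cvgD => //; apply: cvgD => //; exact: cvg_cst.
  apply: cvgB; first by apply: cvgM => //; exact: cvg_cst.
  apply: cvgM; last exact: cvg_cst.
  by under eq_fun do rewrite expr2; exact: (cvgM gN gN).
- apply/cvg_EFin; first by near=> n.
  rewrite -[X in _ --> X]add0r -[X in _ --> X + _]add0r.
  rewrite -{1}(mul0r (ln c)) -{2}(mulr0 K).
  apply: cvgB; last exact: cvg_cst.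
  by apply: cvgD; apply: cvgM => //; exact: cvg_cst.
near=> n.
have Nn : 0 < N n by near: n.
have N2 : 0 < N n ^- 2 by rewrite invr_gt0 exprn_gt0.
have /andP[bp pc] : ((b * expR (- ((N n * g + k n + 1) ^+ 2 / v)))%:E <= p n <=
     (c * expR (K * N n - g ^+ 2 / v * N n ^+ 2))%:E)%E by near: n.
have p0 : (0 <= p n)%E.
  by apply: le_trans bp; rewrite lee_fin mulr_ge0 ?expR_ge0// ltW.
have lnE a x : 0 < a ->
    ((N n ^- 2)%:E * lne (a * expR x)%:E)%E =
    (N n ^- 2 * ln a + N n ^- 2 * x)%:E.
  by move=> a0; rewrite lne_EFin ?mulr_gt0 ?expR_gt0// lnM ?posrE ?expR_gt0//
    expRK -EFinM mulrDr.
have mono x y : (0 <= x)%E -> (x <= y)%E ->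
    ((N n ^- 2)%:E * lne x <= (N n ^- 2)%:E * lne y)%E.
  move=> x0 xy; apply: lee_wpmul2l; first by rewrite lee_fin ltW.
  by rewrite lee_lne// in_itv/= leey andbT// (le_trans x0).
apply/andP; split.
  apply: (le_trans _ (mono _ _ _ bp)); last first.
    by rewrite lee_fin mulr_ge0 ?expR_ge0// ltW.
  rewrite lnE// lee_fin lerD2l le_eqVlt; apply/orP; left; apply/eqP.
  by field; rewrite !gt_eqF.
apply: le_trans (mono _ _ p0 pc) _.
rewrite lnE// lee_fin -addrA lerD2l le_eqVlt; apply/orP; left; apply/eqP.
by field; rewrite !gt_eqF.
Unshelve. all: by end_near. Qed.

Lemma powR_cvgy (R : realType) (a : R) : 0 < a -> x `^ a @[x --> +oo] --> +oo.
Proof.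
move=> a0; apply/cvgryPge => A; near=> x.
have B0 : 0 <= Num.max A 0 by rewrite le_max lexx orbT.
(* With [B = Num.max A 0], nonnegativity gives [B = (B ^ (1 / a)) ^ a], so [x >= B ^ (1 / a)]
   suffices. *)
apply: (@le_trans _ _ (Num.max A 0)); first by rewrite le_max lexx.
rewrite -[leLHS](@powRr1 R)// -(mulVf (lt0r_neq0 a0)) powRrM.
by apply: ge0_ler_powR; rewrite ?nnegrE ?powR_ge0// ?(ltW a0).
Unshelve. all: by end_near. Qed.

Lemma little_o_powR_cvg0 (R : realType) (k : R -> R) (a : R) :
  little_o k (fun n => n `^ a) -> k n / n `^ a @[n --> +oo] --> 0.
Proof.
move=> ko; apply/cvgr0Pnorm_lt => e e0; have [M kM] := ko _ e0.
near=> n; have n0 : 0 < n by [].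
rewrite normrM normfV ltr_pdivrMr ?normr_gt0 ?gt_eqF ?powR_gt0//.
by apply: kM; near: n; apply: nbhs_pinfty_gt; exact: num_real.
Unshelve. all: by end_near. Qed.

(** * Logarithmic asymptotics of Gaussian exceedances *)

(** Stated for arbitrary events [S n] between the two Gaussian events, so that it serves both the
    dual value and the maximum. The index [i0] minimizing [g / s] has the slowest tail decay and
    fixes the rate in both directions. *)
Lemma cvg_lne_gaussian_max (R : realType) (dO : measure_display)
    (Omega : measurableType dO) (P : probability Omega R) (I : finType)
    (X : I -> {RV P >-> R}) (m s g : I -> R) (i0 : I)
    (F : set_system R) (FF : Filter F) (N k : R -> R) (S : R -> set Omega) :
  (forall i, 0 < s i) -> (forall i, 0 < g i) -> 0 <= m i0 ->
  (forall i, has_gaussian_law P (X i) (m i) (s i)) ->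
  (forall i, g i0 / s i0 <= g i / s i) ->
  N n @[n --> F] --> +oo -> k n / N n @[n --> F] --> 0 ->
  (\forall n \near F, [/\ 0 <= k n, measurable (S n),
     [set w | k n < X i0 w - N n * g i0] `<=` S n &
     S n `<=` [set w | exists i, N n * g i < X i w]]) ->
  ((N n ^- 2)%:E * lne (P (S n)))%E @[n --> F] -->
    (- (g i0 ^+ 2 / (2 * s i0 ^+ 2)))%:E.
Proof.
move=> s0 g0 mi0 XN gmin Noo kN hS.
(* Expanding [(N g_i - m_i) ^ 2 / (2 s_i ^ 2)] gives the linear term [m_i g_i N / s_i ^ 2]. A sum of
   nonnegative terms, [K] dominates all these coefficients at once. *)
pose K := \sum_i `|m i| * g i / s i ^+ 2.
have v0 i : 0 < 2 * s i ^+ 2 by rewrite mulr_gt0 ?exprn_gt0.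
have tailE i x : P [set w | x < X i w] = normal_prob (m i) (s i) `]x, +oo[.
  have := XN i `]x, +oo[%classic (measurable_itv _).
  rewrite /gaussian_law gt_eqF// => <-; congr (P _).
  by apply/seteqP; split => w /=; rewrite in_itv/= andbT.
have mtail i x : measurable [set w | x < X i w].
  rewrite (_ : mkset _ = X i @^-1` `]x, +oo[); first exact: measurable_funPTI.
  by apply/seteqP; split => w /=; rewrite in_itv/= andbT.
apply: (@cvg_scaled_lne _ _ _ N k _ (normal_peak (s i0)) #|I|%:R (g i0) _ K)
  => //.
- by rewrite normal_peak_gt0 ?gt_eqF.
- by rewrite ltr0n; apply/card_gt0P; exists i0.
(* The tail bounds apply only beyond the mean; as [I] is finite, all thresholds eventually lie there
   simultaneously. *)
have mN : \forall n \near F, forall i, m i <= N n * g i.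
  apply: filter_forall => i; move/cvgryPge : Noo => /(_ (m i / g i)).
  by apply: filterS => n; rewrite ler_pdivrMr.
have N0 : \forall n \near F, 0 < N n by move/cvgryPgt : Noo; exact.
near=> n.
have Nn : 0 < N n by near: n.
have mNi : forall i, m i <= N n * g i by near: n.
have [k0 mS subS Ssub] : [/\ 0 <= k n, measurable (S n),
     [set w | k n < X i0 w - N n * g i0] `<=` S n &
     S n `<=` [set w | exists i, N n * g i < X i w]] by near: n.
apply/andP; split.
  apply: (@le_trans _ _ (P [set w | N n * g i0 + k n < X i0 w])); last first.
    apply: le_measure; rewrite ?inE// => w /= h; apply: subS => /=.
    by rewrite ltrBrDl.
  rewrite tailE.
  have mx : m i0 <= N n * g i0 + k n by rewrite (le_trans (mNi i0))// lerDl.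
  apply: (le_trans _ (normal_prob_tail_ge _ _ _ _ (s0 i0) mx)).
  (* Dropping the mean only enlarges the square, since [0 <= m i0 <= N n * g i0 + k n]. *)
  rewrite lee_fin ler_pM2l ?normal_peak_gt0 ?gt_eqF// ler_expR lerN2.
  by rewrite ler_pM2r ?invr_gt0//; nra.
apply: (@le_trans _ _ (P (\big[setU/set0]_i [set w | N n * g i < X i w]))).
  apply: le_measure; rewrite ?inE//.
    by apply: bigsetU_measurable => i _; exact: mtail.
  by move=> w /Ssub[i iX]; rewrite (bigD1 i)//=; left.
apply: probability_bigsetU_le => i; first exact: mtail.
rewrite tailE; apply: le_trans (normal_prob_tail_le _ _ _ _ (s0 i) (mNi i)) _.
rewrite lee_fin ler_expR.
have Ki : `|m i| * g i / s i ^+ 2 <= K.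
  rewrite /K (bigD1 i)//= lerDl; apply: sumr_ge0 => j _.
  by rewrite divr_ge0 ?mulr_ge0 ?exprn_ge0// ltW.
(* The quadratic coefficient is half the square of [g / s], hence is smallest at [i0]. *)
have gi : g i0 ^+ 2 / (2 * s i0 ^+ 2) <= g i ^+ 2 / (2 * s i ^+ 2).
  have E j : g j ^+ 2 / (2 * s j ^+ 2) = (g j / s j) ^+ 2 / 2.
    by field; rewrite gt_eqF.
  rewrite !E ler_pM2r ?invr_gt0// ler_pXn2r ?nnegrE//.
    by rewrite ltW// divr_gt0.
  by rewrite ltW// divr_gt0.
apply: (@le_trans _ _ (`|m i| * g i / s i ^+ 2 * N n -
   g i ^+ 2 / (2 * s i ^+ 2) * N n ^+ 2)); last first.
  by rewrite lerB// ler_pM2r// exprn_gt0.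
have -> : `|m i| * g i / s i ^+ 2 = 2 * `|m i| * g i / (2 * s i ^+ 2).
  by field; rewrite gt_eqF.
move: (v0 i); rewrite -invr_gt0; move: (_^-1) => v vp.
(* Expand the square, discard [- m i ^+ 2] and replace [m i] by its absolute value. *)
have h : - (N n * g i - m i) ^+ 2 <=
    2 * `|m i| * g i * N n - g i ^+ 2 * N n ^+ 2.
  have : m i * (g i * N n) <= `|m i| * (g i * N n).
    by rewrite ler_pM2r ?ler_norm// mulr_gt0.
  by have := sqr_ge0 (m i); nra.
by have := ler_wpM2r (ltW vp) h; nra.
Unshelve. all: by end_near. Qed.

Theorem theorem4 (R : realType) (d : nat)
  (E : rel 'I_d) (hE : forall i, incidence_mx R E i i = 0)
  (hirr : irreducible_mx (incidence_mx R E))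
  (A : 'M[R]_d)
  (hA0 : forall i j, incidence_mx R E i j = 0 -> A i j = 0)
  (hA1 : forall i j, incidence_mx R E i j = 1 -> 0 < A i j)
  (hArow : forall i, \sum_(j < d) A i j = 1)
  (T : Type) (t : 'I_d -> T) (hT : range t = [set: T])
  (gamma mu sigma : T -> R)
  (hgamma : forall x, 0 < gamma x)
  (hmu : forall x, 0 < mu x)
  (hsigma : forall x, 0 < sigma x)
  (sigma2 : T -> T -> R)
  (hsigma2 : forall x, sigma2 x x = sigma x ^+ 2)
  (dO : measure_display) (Omega : measurableType dO) (P : probability Omega R)
  (D : T -> {RV P >-> R})
  (hDjoint : jointly_gaussian (fun i : 'I_d => D (t i)))
  (hDmarg : forall i, has_gaussian_law P (D (t i)) (mu (t i)) (sigma (t i)))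
  (hDcov : forall i j,
     covariance P (D (t i)) (D (t j)) = (sigma2 (t i) (t j))%:E)
  (hSigma : sym_posdef (\matrix_(i < d, j < d) sigma2 (t i) (t j)))
  (beta : R) (hbeta : 0 < beta)
  (k : R -> R) (hk0 : forall n : R, 0 < n -> 0 <= k n)
  (hko : little_o k (fun n => n `^ beta))
  (tstar : T) (htstar : argmin (fun x => gamma x / sigma x) tstar) :
  let L (n : R) w :=
    dual_value A (\col_(i < d) D (t i) w)
      (\col_(i < d) supply beta gamma n (t i)) in
  let M (n : R) w :=
    (\big[maxe/-oo]_(i < d) (D (t i) w - supply beta gamma n (t i))%:E)%E in
  let rate := - (gamma tstar ^+ 2 / (2 * sigma tstar ^+ 2)) in
  ((n `^ (- (2 * beta)))%:E * lne (P [set w | (k n)%:E < L n w]))%E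
      @[n --> +oo] --> rate%:E
  /\
  ((n `^ (- (2 * beta)))%:E * lne (P [set w | (k n)%:E < M n w]))%E
      @[n --> +oo] --> rate%:E.
Proof.
move=> L M rate.
(* The minimizing location is lifted to a node index, since the Gaussian estimate is indexed by
   nodes. *)
have [i0 _ ti0] : range t tstar by rewrite hT.
have A0 i j : 0 <= A i j.
  have [E0|E1] := boolP (E i j); last by rewrite hA0// mxE (negbTE E1).
  by rewrite ltW// hA1// mxE E0.
have NE n : n `^ (- (2 * beta)) = (n `^ beta) ^- 2.
  by rewrite powRN mulrC powRrM powR_mulrn ?powR_ge0.
(* Both limits follow from the same sandwich with [N = n ^ beta]; only measurability and the two
   inclusions remain to be checked for each event. *)
have key (S : R -> set Omega) :
    (forall n, 0 < n -> [/\ measurable (S n),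
     [set w | k n < D (t i0) w - supply beta gamma n (t i0)] `<=` S n &
     S n `<=` [set w | exists i, supply beta gamma n (t i) < D (t i) w]]) ->
    ((n `^ (- (2 * beta)))%:E * lne (P (S n)))%E @[n --> +oo] --> rate%:E.
  move=> hS; under eq_fun do rewrite NE.
  rewrite /rate -ti0.
  apply: (@cvg_lne_gaussian_max _ _ _ P _ (fun i => D (t i)) (mu \o t)
    (sigma \o t) (gamma \o t) i0 _ _ (fun n => n `^ beta) k S) => //=.
  - exact: ltW.
  - by move=> i; rewrite ti0; exact: htstar.
  - exact: powR_cvgy.
  - exact: little_o_powR_cvg0.
  near=> n; have n0 : 0 < n by [].
  by have [? ? ?] := hS n n0; split=> //; exact: hk0.
have kD n i w : k n < D (t i) w - supply beta gamma n (t i) ->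
    ((k n)%:E < (D (t i) w - supply beta gamma n (t i))%:E)%E.
  by rewrite lte_fin.
split; apply: key => n n0; split.
- by apply: measurable_dual_value_gt => i; exact: measurable_funP.
- move=> w /= /kD/lt_le_trans; apply.
  have := @le_dual_value _ _ A (\col_i D (t i) w)
    (\col_i supply beta gamma n (t i)) i0.
  by rewrite !mxE; apply.
- move=> w /= kL; have [|i] := @dual_value_gt0 _ _ A (\col_i D (t i) w)
    (\col_i supply beta gamma n (t i)).
    by apply: le_lt_trans kL; rewrite lee_fin hk0.
  by rewrite !mxE; exists i.
- rewrite (_ : mkset _ = \bigcup_(i in [set: 'I_d])
      [set w | k n < D (t i) w - supply beta gamma n (t i)]).
    apply: fin_bigcup_measurable => [|i _]; first exact: finite_finset.
    rewrite (_ : mkset _ =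
      D (t i) @^-1` `]k n + supply beta gamma n (t i), +oo[).
      exact: measurable_funPTI.
    by apply/seteqP; split => w /=; rewrite in_itv/= andbT ltrBrDr.
  apply/seteqP; split => w /=.
    (* The default [-oo] of the maximum never exceeds the real [k n], so some node must. *)
    by move=> /bigmax_gtP[//|[i _]]; rewrite lte_fin => h; exists i.
  by move=> [i _ /kD h]; apply/bigmax_gtP; right; exists i.
- by move=> w /= /kD h; apply/bigmax_gtP; right; exists i0.
- move=> w /= /bigmax_gtP[//|[i _]]; rewrite lte_fin => h.
  (* As [k n >= 0], an excess above [k n] is a positive excess over the supply. *)
  by exists i; rewrite -subr_gt0; apply: le_lt_trans h; exact: hk0.
Unshelve. all: by end_near. Qed.
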